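(* There is an absolute constant $c>0$ such that the following holds. For each $n\ge 1$ let $x,y$ be chosen independently and uniformly at random from the symmetric group $S_n$, and let $S=\{x,x^{-1},y,y^{-1}\}$. Then $$\mathbf{P}\left(\operatorname{girth}(\operatorname{Cay}(S_n,S))\ge c\,n^{1/3}\right)\longrightarrow 1\quad\text{as } n\to\infty.$$
   Context: $S_n$ denotes the symmetric group of degree $n$. For a group $G$ and a symmetric subset $S\subset G$ (i.e. $S=S^{-1}$), the Cayley graph $\operatorname{Cay}(G,S)$ is the graph with vertex set $G$ in which $g$ is joined to $gs$ for each $g\in G$ and $s\in S$. The girth of a graph is the length of its shortest cycle. *)

(* Defs.v *)
From HB Require Import structures.
From mathcomp Require Import all_boot all_order all_algebra all_fingroup.
From mathcomp Require Import all_classical all_reals all_analysis.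

Set Implicit Arguments.
Unset Strict Implicit.
Unset Printing Implicit Defensive.

Import Order.TTheory GRing.Theory Num.Theory.

Local Open Scope ring_scope.

Definition Cay (gT : finGroupType) (S : {set gT}) : rel gT :=
  fun g h => [exists s in S, h == (g * s)%g].

(* Excluding size 0 and size 2 rules out the empty sequence and the back and
   forth walk along an edge; a loop counts as a cycle of length 1. *)
Definition graph_cycle (T : eqType) (e : rel T) (p : seq T) : bool :=
  [&& ucycleb e p, size p != 0%N & size p != 2%N].

(* The girth of a forest is +oo, the infimum of the empty set. *)
Definition girth (R : realType) (T : eqType) (e : rel T) : \bar R :=
  ereal_inf [set (size p)%:R%:E | p in [set p | graph_cycle e p]]%classic.

Definition sym_gens (gT : finGroupType) (x y : gT) : {set gT} :=
  [set x; x^-1; y; y^-1]%g%SET.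

Definition finite_unif_pr (R : realType) (T : finType) (A : {set T}) : R :=
  #|A|%:R / #|[set: T]%SET|%:R.

(* Main.v *)
(* A cycle of length m in the Cayley graph yields a nonempty reduced word w of
   length m with w(x, y) = 1. Follow the trajectory of a point under w, revealing
   x and y only where needed: as w is reduced, as long as the visited points are
   new each step asks for an unknown value, and the trajectory can close up only
   if one of these at most L values hits one of the at most M points seen so far,
   an event of conditional probability at most L M / (n - M). Repeating this with
   L successively unseen starting points gives M = L (L + 1) and, if
   18 L^3 <= n, P(w(x, y) = 1) <= 8^-L, which beats the 4^(L+1) words of length
   at most L. Conditional probabilities are replaced by a switching injection. *)
Require Import Defs.
From HB Require Import structures.
From mathcomp Require Import all_boot all_order all_algebra all_fingroup.
From mathcomp Require Import all_classical all_reals all_analysis.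
From mathcomp Require Import zify.

Set Implicit Arguments.
Unset Strict Implicit.
Unset Printing Implicit Defensive.

(** * Words in two generators and the switching of one generator *)

(* A letter is a pair (which generator, positive exponent?). *)
Notation letter := (bool * bool)%type.

Definition inv_letter (l : letter) : letter := (l.1, ~~ l.2).

Definition reduced (w : seq letter) : bool :=
  sorted (fun k l => l != inv_letter k) w.

Section Words.
Variable gT : finGroupType.
Implicit Types (xy : gT * gT) (k l : letter) (s : gT).
Local Open Scope group_scope.

Definition gen xy l : gT :=
  let g := if l.1 then xy.1 else xy.2 in if l.2 then g else g^-1.

Definition eval_word xy (w : seq letter) : gT := \prod_(l <- w) gen xy l.

Lemma gen_inv xy l : gen xy (inv_letter l) = (gen xy l)^-1.
Proof. by case: l => [[] []]; rewrite /gen /= ?invgK. Qed.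

(** The case split on the sign makes the value of the letter [l] itself, positive or negative, be
    multiplied by [s] on the right. *)
Definition switch xy l s : gT * gT :=
  let f g := if l.2 then g * s else s^-1 * g in
  if l.1 then (f xy.1, xy.2) else (xy.1, f xy.2).

Lemma gen_switch xy l s k :
  gen (switch xy l s) k =
  if k == l then gen xy l * s
  else if k == inv_letter l then s^-1 * gen xy k else gen xy k.
Proof.
by case: l k => [[] []] [[] []]; rewrite /gen /switch //= !invMg ?invgK.
Qed.

Lemma switchK xy l s : switch (switch xy l s) l s^-1 = xy.
Proof.
by case: xy l => x y [[] []]; rewrite /switch /= ?invgK ?mulgK ?mulKVg.
Qed.

End Words.

(** * Trajectories of a point under redirection of an edge *)

Section Trajectories.
Variable T : finType.
Implicit Types (xy : {perm T} * {perm T}) (k l : letter) (u w : seq letter).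
Implicit Types (a b v z : T) (V : {set T}) (A : {set {perm T} * {perm T}}).

Definition traj xy v w : seq T := v :: scanl (fun z l => gen xy l z) v w.

Lemma traj_cons xy v l w : traj xy v (l :: w) = v :: traj xy (gen xy l v) w.
Proof. by []. Qed.

Lemma size_traj xy v w : size (traj xy v w) = (size w).+1.
Proof. by rewrite /= size_scanl. Qed.

Lemma last_traj xy v w z : last z (traj xy v w) = eval_word xy w v.
Proof.
rewrite /eval_word; elim: w v z => [|l w IHw] v z /=; first by rewrite big_nil perm1.
by rewrite big_cons permM -[RHS](IHw _ v).
Qed.

Lemma mem_eval_word xy v w : eval_word xy w v \in traj xy v w.
Proof. by rewrite -(last_traj xy v w v) [last _ _]/= mem_last. Qed.

Lemma traj_rcons xy v w l :
  traj xy v (rcons w l) = rcons (traj xy v w) (gen xy l (eval_word xy w v)).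
Proof.
elim: w v => [|k w IHw] v; first by rewrite /eval_word big_nil perm1.
by rewrite rcons_cons !traj_cons IHw /= /eval_word big_cons permM.
Qed.

Definition fresh V (s : seq T) : bool := uniq s && all (fun z => z \notin V) s.

(* Replaces the edge a -> b labelled by l by a -> b', and gives b the former
   l-preimage of b'. *)
Definition redirect xy l a b' := switch xy l (tperm (gen xy l a) b').

Lemma gen_redirect xy l a b' : gen (redirect xy l a b') l a = b'.
Proof. by rewrite gen_switch eqxx permM tpermL. Qed.

Lemma redirectK xy l a b' : redirect (redirect xy l a b') l a (gen xy l a) = xy.
Proof.
by rewrite {1}/redirect gen_redirect tpermC -tpermV switchK.
Qed.

(** Only the [l]-edges into [gen xy l a] and into [b'] are moved. The hypotheses keep the step from
    [z] off both of them, traversed forwards or backwards. *)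
Lemma gen_redirect_id xy l a b' k z :
    (k = l -> z != a) -> (k = inv_letter l -> gen xy k z != a) ->
    z != b' -> gen xy k z != b' ->
  gen (redirect xy l a b') k z = gen xy k z.
Proof.
move=> kl kl' zb' kzb'; rewrite gen_switch.
have [klE|_] := eqVneq k l.
  rewrite permM klE tpermD -?klE 1?eq_sym //.
  by rewrite (inj_eq perm_inj) kl.
case: eqP => // klE.
rewrite permM tpermV tpermD 1?eq_sym //.
apply: contra_neq (kl' klE) => ->.
by rewrite klE gen_inv permK.
Qed.

(* In the exceptional case a is the end of u, and reducedness of u l says that
   the edge leaving a along l has not been traversed by u. *)
Lemma traj_redirect xy l a b' v u :
    b' \notin traj xy v u ->
    (a \in traj xy v u ->
       [/\ uniq (traj xy v u), a = eval_word xy u v & reduced (rcons u l)]) ->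
  traj (redirect xy l a b') v u = traj xy v u.
Proof.
elim: u v => [//|k u IHu] v; rewrite !traj_cons inE negb_or => /andP[b'v b'u] Ha.
have b'k : b' != gen xy k v by move: b'u; rewrite inE negb_or => /andP[].
have ev : eval_word xy (k :: u) v = eval_word xy u (gen xy k v).
  by rewrite /eval_word big_cons permM.
have Hk : gen (redirect xy l a b') k v = gen xy k v.
  apply: gen_redirect_id; rewrite 1?eq_sym // => kE; apply/eqP => aE.
    have [] := Ha; rewrite ?aE ?mem_head // => /andP[+ _] vE _.
    by move/negP; apply; rewrite [X in X \in _]vE ev mem_eval_word.
  (* The second point is now [a], the end of the trajectory: if [u] is empty, [k] followed by [l] is
     not reduced, and otherwise [a] occurs twice. *)
  have [] := Ha; first by rewrite inE aE [_ \in traj _ _ _]mem_head orbT.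
  rewrite cons_uniq ev {}aE => /andP[_]; case: u {IHu b'u Ha ev} => [_ _|k' u].
    by rewrite /reduced /= kE /inv_letter /= negbK -surjective_pairing eqxx.
  rewrite traj_cons cons_uniq => /andP[+ _] aE _.
  move/negP; apply; rewrite [X in X \in _]aE.
  by rewrite /eval_word big_cons permM mem_eval_word.
rewrite Hk IHu // => au; have [|/andP[_ uu] aE red] := Ha.
- by rewrite inE au orbT.
split=> //; first by rewrite aE ev.
by apply: path_sorted red.
Qed.

(* Membership depends only on the edges inside V: this is the form in which the
   information revealed so far is recorded. *)
Definition determined_on V A := forall xy l a b',
  xy \in A -> a \notin V -> b' \notin V -> redirect xy l a b' \in A.

(** Conditioning on a trajectory reveals only its own points: by [traj_redirect], redirection
    between vertices off it leaves it unchanged. *)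
Lemma determined_on_traj V A v w t :
    determined_on V A ->
  determined_on (V :|: [set z in t]) [set xy in A | traj xy v w == t].
Proof.
move=> detA xy l a b'; rewrite !inE !negb_or => /andP[xyA /eqP tE].
move=> /andP[aV at_] /andP[b'V b't]; rewrite detA //=.
by rewrite traj_redirect tE // (negPf at_).
Qed.

(** * Counting by switching *)

Lemma card_dep_pairs (I J : finType) (B : {set I}) (S : I -> {set J}) :
  #|[set p : I * J | (p.1 \in B) && (p.2 \in S p.1)]| = \sum_(i in B) #|S i|.
Proof.
under eq_bigr do rewrite -sum1_card.
by rewrite pair_big_dep /= -sum1_card; apply: eq_bigl => p; rewrite inE.
Qed.

Definition coincidence A V v u l :=
  [set xy in A | fresh V (traj xy v u) &
     (eval_word xy (rcons u l) v \in V :|: [set z in traj xy v u])].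

Lemma eval_word_rcons xy u l v :
  eval_word xy (rcons u l) v = gen xy l (eval_word xy u v).
Proof. by rewrite /eval_word -cats1 big_cat big_seq1 permM. Qed.

(* Redirecting the last edge to any of the at least #|T| - M vertices not yet
   seen is injective once the old endpoint, one of at most M, is recorded. *)
Lemma card_coincidence A V v u l M :
    determined_on V A -> reduced (rcons u l) -> #|V| + (size u).+1 <= M ->
  #|coincidence A V v u l| * (#|T| - M) <= M * #|A|.
Proof.
move=> detA red_ul leM.
pose S xy := V :|: [set z in traj xy v u].
have cardS xy : #|S xy| <= M.
  apply: leq_trans leM; apply: leq_trans (leq_card_setU _ _) _.
  by rewrite leq_add2l cardsE -(size_traj xy v) card_size.
pose P := [set p : ({perm T} * {perm T}) * T |
  (p.1 \in coincidence A V v u l) && (p.2 \in ~: S p.1)].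
pose Q := [set p : ({perm T} * {perm T}) * T | (p.1 \in A) && (p.2 \in S p.1)].
pose e xy := eval_word xy u v.
pose f (p : ({perm T} * {perm T}) * T) :=
  (redirect p.1 l (e p.1) p.2, gen p.1 l (e p.1)).
have trajP p : p \in P -> traj (f p).1 v u = traj p.1 v u.
  rewrite !inE => /andP[/and3P[_ /andP[uq _] _]] /norP[_ b't].
  by apply: traj_redirect.
have eP p : p \in P -> e (f p).1 = e p.1.
  by move=> /trajP tE; rewrite /e -!(last_traj _ _ _ v) tE.
(* Redirecting back to the recorded old endpoint undoes [f]. *)
have fK : {in P, cancel f f}.
  move=> p pP; rewrite {1}/f eP // [(f p).2]/= redirectK gen_redirect.
  by case: p {pP}.
have fQ : f @: P \subset Q.
  apply/fintype.subsetP => _ /imsetP[p pP ->]; rewrite inE /S trajP //.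
  move: pP; rewrite !inE eval_word_rcons.
  move=> /andP[/and3P[pA /andP[_ /allP fr] inS]] /norP[b'V b't].
  rewrite inS andbT detA //; apply: fr.
  exact: mem_eval_word.
have cardP : #|P| = #|f @: P| by rewrite (card_in_imset (can_in_inj fK)).
have leP : #|coincidence A V v u l| * (#|T| - M) <= #|P|.
  rewrite (card_dep_pairs _ (fun xy => ~: S xy)) -sum_nat_const leq_sum // => xy _.
  by rewrite -(cardsC (S xy)) leq_subLR leq_add2r.
apply: leq_trans leP _; rewrite cardP; apply: leq_trans (subset_leq_card fQ) _.
by rewrite (card_dep_pairs _ S) mulnC -sum_nat_const leq_sum.
Qed.

(** Freshness is first lost at some letter of [w], and the loss there is a coincidence for the
    preceding prefix; the bounds for these events add up to the factor [size w]. *)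
Lemma card_not_fresh A V v w M :
    determined_on V A -> v \notin V -> reduced w -> #|V| + size w <= M ->
  #|[set xy in A | ~~ fresh V (traj xy v w)]| * (#|T| - M) <= size w * M * #|A|.
Proof.
move=> detA vV; elim/last_ind: w => [_ _|w l IHw red leM].
  rewrite (_ : [set _ in _ | _] = finset.set0) ?cards0 //.
  by apply/finset.setP => xy; rewrite !inE /fresh /= vV andbF.
have red_w : reduced w.
  move: red; rewrite /reduced -cats1.
  by case: (w) => //= k w'; rewrite cat_path => /andP[].
rewrite size_rcons in leM *.
have lew : #|V| + size w <= M by lia.
set B := [set _ in _ | _].
have subB : B \subset [set xy in A | ~~ fresh V (traj xy v w)]
                      :|: coincidence A V v w l.
  apply/fintype.subsetP => xy; rewrite !inE => /andP[-> /=].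
  rewrite traj_rcons -eval_word_rcons /fresh rcons_uniq all_rcons.
  case: (uniq _); case: (all _ _); rewrite ?andbT ?andbF //.
  by rewrite negb_and !negbK orbC.
have leB := leq_trans (subset_leq_card subB) (leq_card_setU _ _).
apply: leq_trans (leq_mul leB (leqnn _)) _.
rewrite mulnDl mulSn mulnDl addnC leq_add ?IHw //.
exact: card_coincidence.
Qed.

Definition kernel_pairs A w := [set xy in A | eval_word xy w == 1%g].

(** Each of [t] successive starting points gains a factor [size w * M / (#|T| - M)]. Sorting by the
    full trajectory of a new point [v] gives classes to which the induction hypothesis applies, and
    only the non-fresh classes can contain a relation. *)
Lemma card_kernel_pairs_determined A V w M t :
    determined_on V A -> reduced w -> 0 < size w ->
    #|V| + t * (size w).+1 <= M -> M < #|T| ->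
  #|kernel_pairs A w| * (#|T| - M) ^ t <= (size w * M) ^ t * #|A|.
Proof.
move=> + red w0 + ltM.
elim: t A V => [|t IHt] A V detA leM.
  by rewrite muln1 mul1n subset_leq_card //; apply/fintype.subsetP => xy /setIdP[].
have [v vV] : exists v, v \notin V.
  have : 0 < #|~: V| by have := cardsC V; lia.
  by case/card_gt0P => v; rewrite inE; exists v.
have trajS xy : size (traj xy v w) == (size w).+1 by rewrite size_traj.
pose tr xy : (size w).+1.-tuple T := Tuple (trajS xy).
pose bad := [set xy in A | ~~ fresh V (traj xy v w)].
have card_by_traj (A' : {set _}) : #|A'| =
    \sum_(s : (size w).+1.-tuple T) #|[set xy in A' | traj xy v w == tval s]|.
  rewrite -sum1_card (partition_big tr predT) //=; apply: eq_bigr => s _.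
  by rewrite -sum1_card; apply: eq_bigl => xy; rewrite inE -val_eqE.
have step (s : (size w).+1.-tuple T) :
    #|[set xy in kernel_pairs A w | traj xy v w == tval s]| * (#|T| - M) ^ t
      <= (size w * M) ^ t * #|[set xy in bad | traj xy v w == tval s]|.
  have [frs|nfrs] := boolP (fresh V s).
    rewrite (_ : [set _ in kernel_pairs A w | _] = finset.set0) ?cards0 //.
    apply/finset.setP => xy; rewrite !inE; apply/negP => /andP[/andP[_ /eqP w1] /eqP ts].
    move: frs; rewrite -ts => /andP[+ _].
    (* A nonempty [w] fixing [v] brings the trajectory back to its start, so it is not [uniq]. *)
    case: (w) w0 w1 => // l w' _ w1; rewrite traj_cons cons_uniq => /andP[/negP[]].
    have ev : eval_word xy w' (gen xy l v) = v.
      by rewrite -[RHS]perm1 -w1 /eval_word big_cons permM.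
    by rewrite -[X in X \in _]ev mem_eval_word.
  have leV : #|V :|: [set z in tval s]| + t * (size w).+1 <= M.
    apply: leq_trans leM; rewrite mulSn addnA leq_add2r.
    apply: leq_trans (leq_card_setU _ _) _; rewrite leq_add2l cardsE.
    by rewrite (leq_trans (card_size _)) ?size_tuple.
  have -> : [set xy in kernel_pairs A w | traj xy v w == tval s] =
            kernel_pairs [set xy in A | traj xy v w == tval s] w.
    by apply/finset.setP => xy; rewrite !inE -!andbA; congr andb; rewrite andbC.
  have -> : [set xy in bad | traj xy v w == tval s] =
            [set xy in A | traj xy v w == tval s].
    (* Freshness depends on the trajectory alone, so the whole class of [s] is bad. *)
    apply/finset.setP => xy; rewrite !inE -!andbA; congr andb.
    by case: eqP => [->|]; rewrite ?nfrs ?andbF.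
  exact: IHt (determined_on_traj detA) leV.
have le1 : #|kernel_pairs A w| * (#|T| - M) ^ t <= (size w * M) ^ t * #|bad|.
  by rewrite [in leqLHS]card_by_traj [in leqRHS]card_by_traj big_distrl big_distrr leq_sum.
rewrite expnSr mulnA; apply: leq_trans (leq_mul le1 (leqnn _)) _.
rewrite expnSr -!mulnA leq_mul // mulnA card_not_fresh //.
by move: leM; rewrite mulSn; lia.
Qed.

End Trajectories.

(** * Union bound over short words *)

Lemma card_bigcup_le (I T : finType) (P : pred I) (F : I -> {set T}) :
  #|(\bigcup_(i | P i) F i)%SET| <= \sum_(i | P i) #|F i|.
Proof.
elim/big_rec2: _ => [|i k B _ leB]; first by rewrite cards0.
by rewrite (leq_trans (leq_card_setU _ _)) // leq_add2l.
Qed.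

Lemma card_kernel_pairs (T : finType) (w : seq letter) L :
    reduced w -> 0 < size w <= L -> 18 * L ^ 3 <= #|T| ->
  #|kernel_pairs [set: {perm T} * {perm T}] w| * 8 ^ L
    <= #|{: {perm T} * {perm T}}|.
Proof.
move=> red /andP[w0 wL] leT; pose M := L * L.+1.
have le8 : 8 * (size w * M) <= #|T| - M.
  have : 8 * (size w * M) <= 8 * (L * M) by rewrite leq_mul2l leq_mul2r wL orbT.
  (* The left side is [8 L^3 + 9 L^2 + L], whence the constant 18. *)
  have : 8 * (L * M) + M <= 18 * L ^ 3.
    have : L * L <= L * (L * L) by nia.
    by rewrite /M !expnS expn0; nia.
  lia.
have M0 : 0 < size w * M by rewrite /M; nia.
have := @card_kernel_pairs_determined T [set: _]%SET finset.set0 w M L _ red w0.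
rewrite cards0 add0n finset.cardsT => bound.
have {bound}leK : #|kernel_pairs [set: {perm T} * {perm T}] w| * (#|T| - M) ^ L
                  <= (size w * M) ^ L * #|{: {perm T} * {perm T}}|.
  apply: bound; last by lia.
    by move=> *; rewrite inE.
  by rewrite /M leq_mul2l ltnS wL orbT.
have D0 : 0 < (size w * M) ^ L by rewrite expn_gt0 M0.
rewrite -(leq_pmul2l D0); apply: leq_trans leK.
rewrite mulnCA leq_mul2l -expnMn mulnC leq_exp2r ?le8 ?orbT //.
exact: leq_trans w0 wL.
Qed.

Definition short_relation_pairs (T : finType) L : {set {perm T} * {perm T}} :=
  (\bigcup_(m < L.+1) \bigcup_(w : m.-tuple letter | reduced w && (0 < size w))
     kernel_pairs [set: {perm T} * {perm T}] w)%SET.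

Lemma card_short_relation_pairs (T : finType) L :
    18 * L ^ 3 <= #|T| ->
  #|short_relation_pairs T L| * 2 ^ L <= 4 * #|{: {perm T} * {perm T}}|.
Proof.
move=> leT; set N := #|{: _}|.
have le8 : #|short_relation_pairs T L| * 8 ^ L <= \sum_(m < L.+1) 4 ^ m * N.
  rewrite (leq_trans (leq_mul (card_bigcup_le _ _) (leqnn _))) // big_distrl leq_sum // => m _.
  rewrite (leq_trans (leq_mul (card_bigcup_le _ _) (leqnn _))) // big_distrl.
  have -> : 4 ^ m * N = \sum_(w : m.-tuple letter) N.
    by rewrite sum_nat_const card_tuple card_prod card_bool.
  rewrite big_mkcond leq_sum // => w _; case: ifP => // /andP[red w0].
  by rewrite card_kernel_pairs // w0 size_tuple -ltnS ltn_ord.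
have le4 : \sum_(m < L.+1) 4 ^ m * N <= 4 ^ L.+1 * N.
  rewrite -big_distrl leq_mul2r; apply/orP; right.
  elim: (L.+1) => [|k IHk]; first by rewrite big_ord0.
  by rewrite big_ord_recr /= (leq_trans (leq_add IHk (leqnn _))) // expnS !mulSn leq_add2l leq_addr.
(* Since [8 ^ L = 4 ^ L * 2 ^ L], the number of words cancels up to a factor 4. *)
rewrite -(@leq_pmul2r (4 ^ L)) ?expn_gt0 // -mulnA -expnMn.
by rewrite (leq_trans le8) // (leq_trans le4) // expnS mulnAC.
Qed.

(** * From cycles to relations *)

Section Cycles.
Variable gT : finGroupType.
Implicit Types (xy : gT * gT) (g h s : gT).
Local Open Scope group_scope.

(** The generators and their inverses may coincide, so one letter is chosen for each element by
    testing in a fixed order. *)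
Definition letter_of xy s : letter :=
  if s == xy.1 then (true, true) else if s == xy.1^-1 then (true, false)
  else (false, s == xy.2).

Lemma gen_letter_of xy s : s \in sym_gens xy.1 xy.2 -> gen xy (letter_of xy s) = s.
Proof.
rewrite !inE /letter_of -!orbA; case: eqP => [->|] //= _.
case: eqP => [->|] //= _; rewrite /gen /=.
by case: eqP => [->|] //= _ /eqP.
Qed.

Lemma prod_quotients (g : nat -> gT) n :
  \prod_(i <- iota 0 n) ((g i)^-1 * g i.+1) = (g 0%N)^-1 * g n.
Proof.
elim: n => [|n IHn]; first by rewrite big_nil mulVg.
by rewrite -addn1 iotaD big_cat IHn big_seq1 /= add0n addn1 -mulgA mulKVg.
Qed.

(** The quotients of successive vertices spell the word and their product telescopes to 1. Two
    adjacent inverse letters would give [v i.+2 = v i], a backtracking. *)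
Lemma cycle_relation xy (p : seq gT) :
    graph_cycle (Cay (sym_gens xy.1 xy.2)) p ->
  exists w, [/\ size w = size p, reduced w & eval_word xy w = 1].
Proof.
case: p => [|g0 p'] /and3P[/andP[cyc uq] // _]; set m := size _ => m2.
(* As g0 is the default value, v m = v 0 closes the cycle. *)
pose v i := nth g0 (g0 :: p') i.
pose s i := (v i)^-1 * v i.+1.
have sS i : i < m -> s i \in sym_gens xy.1 xy.2.
  move=> im; have := pathP g0 cyc i; rewrite size_rcons => /(_ im).
  rewrite -rcons_cons nth_rcons im -/(v i) => /existsP[t /andP[tS]].
  have -> : nth g0 (rcons p' g0) i = v i.+1.
    by rewrite nth_rcons if_same /v /=; case: ltnP => // le; rewrite nth_default.
  by move=> /eqP; rewrite /s => ->; rewrite mulKg.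
exists [seq letter_of xy (s i) | i <- iota 0 m]; split.
- by rewrite size_map size_iota.
- apply/(sortedP (true, true)) => i; rewrite size_map size_iota => im.
  have im' := ltnW im.
  rewrite !(nth_map 0%N) ?size_iota // !nth_iota // !add0n.
  apply/eqP => /(congr1 (gen xy)); rewrite gen_inv !gen_letter_of ?sS //.
  rewrite /s invMg invgK => /mulgI vE.
  (* If [i.+2 = m], then [v i = v 0] forces [i = 0] and a cycle of the excluded length 2; otherwise
     two distinct positions carry the same vertex. *)
  move: (im); rewrite leq_eqVlt => /orP[/eqP mE|im2].
    move: vE; rewrite mE /v nth_default // -[g0 in LHS]/(nth g0 (g0 :: p') 0%N).
    move=> /eqP; rewrite nth_uniq // => /eqP iE.
    by move: m2; rewrite -mE -iE.
  move: vE => /eqP; rewrite nth_uniq // => /eqP; lia.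
- rewrite /eval_word big_map big_seq.
  rewrite (eq_bigr s) => [|i]; last first.
    by rewrite mem_iota => /andP[_ im]; rewrite gen_letter_of ?sS.
  have vm : v m = v 0%N by apply: nth_default.
  by rewrite -big_seq prod_quotients vm mulVg.
Qed.

End Cycles.

Lemma graph_cycle_size (T : finType) (xy : {perm T} * {perm T}) L p :
    xy \notin short_relation_pairs T L ->
    graph_cycle (Cay (sym_gens xy.1 xy.2)) p ->
  L < size p.
Proof.
move=> nrel cyc; rewrite ltnNge; apply: contra nrel => leL.
have p0 : 0 < size p by rewrite lt0n; case/and3P: cyc.
have [w [wE red w1]] := cycle_relation cyc.
apply/bigcupP; exists (inord (size p)) => //; rewrite inordK //.
have szw : size w == size p by rewrite wE.
apply/bigcupP; exists (Tuple szw); first by rewrite red wE.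
by rewrite !inE; apply/eqP.
Qed.

(** * Cube roots and the limit *)

Import Order.TTheory GRing.Theory Num.Theory numFieldNormedType.Exports.

Local Open Scope classical_set_scope.
Local Open Scope ring_scope.

Lemma powR_cbrt_le (R : realType) (n k : nat) :
  (n <= 27 * k ^ 3)%N -> 3^-1 * n%:R `^ 3^-1 <= k%:R :> R.
Proof.
move=> le_n; rewrite ler_pdivrMl //.
have -> : 3 * k%:R = ((3 * k%:R) `^ 3%:R) `^ 3^-1 :> R.
  by rewrite -powRrM divff ?pnatr_eq0 // powRr1 // mulr_ge0.
rewrite ge0_ler_powR ?nnegrE ?powR_ge0 ?invr_ge0 //.
rewrite powR_mulrn ?mulr_ge0 // exprMn -!natrX -natrM ler_nat.
exact: le_n.
Qed.

Lemma cube_bracket n : exists L, (18 * L ^ 3 <= n < 18 * L.+1 ^ 3)%N.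
Proof.
have exL : exists L, (18 * L ^ 3 <= n)%N by exists 0%N.
have ubL L : (18 * L ^ 3 <= n)%N -> (L <= n)%N by rewrite !expnS; nia.
case: (ex_maxnP exL ubL) => L leL maxL; exists L; rewrite leL ltnNge /=.
by apply/negP => /maxL; rewrite ltnn.
Qed.

Lemma finite_unif_pr_compl (R : realType) (T : finType) (A : {set T}) :
  (0 < #|T|)%N -> 1 - finite_unif_pr R A = #|~: A|%:R / #|T|%:R.
Proof.
move=> T0; rewrite /finite_unif_pr finset.cardsT -(cardsC A).
have NE : (#|A| + #|~: A|)%:R != 0 :> R by rewrite cardsC pnatr_eq0 -lt0n.
by rewrite -{1}(divff NE) -mulrBl natrD addrAC subrr add0r.
Qed.

Theorem theorem1p1 (R : realType) :
  exists c : R, 0 < c /\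
    (fun n : nat =>
       finite_unif_pr R
         [set xy : 'S_n * 'S_n |
           ((c * n%:R `^ 3^-1)%:E
              <= girth R (Cay (sym_gens xy.1 xy.2)))%E]%SET) @ \oo --> (1 : R).
Proof.
(* Cycles will be longer than [L], where [n < 18 * L.+1 ^ 3 <= 27 * L.+1 ^ 3]; the cube root of 27
   gives the constant. *)
exists 3^-1; split; first by rewrite invr_gt0.
(* The failure probability is at most [4 / 2 ^ L], which is below [e] once [L >= K], because
   [4 / e < K <= L < 2 ^ L]. *)
apply/cvgrPdist_le => e e0; set K := Num.bound (4 / e).
near=> n.
have [L /andP[leL ltL]] := cube_bracket n.
have KL : (K <= L)%N.
  have : (18 * K ^ 3 <= n)%N by near: n; exact: nbhs_infty_ge.
  move=> /leq_ltn_trans/(_ ltL); by rewrite ltn_pmul2l // ltn_exp2r.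
set A := [set xy | _]%SET.
have pairs0 : (0 < #|{: 'S_n * 'S_n}|)%N by apply/card_gt0P; exists (1%g, 1%g).
have subA : ~: A \subset short_relation_pairs 'I_n L.
  apply/fintype.subsetP => xy; rewrite !inE; apply: contraR => nrel.
  apply: le_ereal_inf_tmp => _ [p /= cyc <-]; rewrite lee_fin.
  apply: powR_cbrt_le; apply: leq_trans (ltnW ltL) _.
  by rewrite leq_mul // leq_exp2r // (graph_cycle_size nrel cyc).
have leA : (#|~: A| * 2 ^ L <= 4 * #|{: 'S_n * 'S_n}|)%N.
  have := @card_short_relation_pairs 'I_n L; rewrite card_ord => /(_ leL).
  apply: leq_trans.
  by rewrite leq_mul2r subset_leq_card ?orbT.
rewrite finite_unif_pr_compl // ger0_norm ?divr_ge0 //.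
have lt2 : 4 / e < (2 ^ L)%:R.
  apply: (lt_le_trans (archi_boundP _)); first by rewrite divr_ge0 ?ltW.
  by rewrite ler_nat -/K; apply: leq_trans KL _; apply/ltnW/ltn_expl.
rewrite ler_pdivrMr ?ltr0n //.
rewrite -(ler_pM2r (x := (2 ^ L)%:R)) ?ltr0n ?expn_gt0 // -natrM.
apply: le_trans (_ : (4 * #|{: 'S_n * 'S_n}|)%:R <= _); first by rewrite ler_nat.
rewrite mulrAC natrM ler_wpM2r //.
by rewrite mulrC -ler_pdivrMr // ltW.
Unshelve. all: by end_near.
Qed.
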